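(* Let $\mu$ be a non-atomic probability measure on $(\mathbb{R}^N,d)$. Let $\beta\in(0,1]$, $\Phi(x)=x(\log(1+x))^\beta$, and assume that for some constant $c\in(0,\infty)$ the inequality $$\mu\left(\Phi(|f|)\right)-\Phi(\mu|f|)\le c\,\mu|\nabla f|$$ holds for all locally Lipschitz functions $f$. Then, with $q=\frac1\beta$, there is a constant $\tilde c>0$ such that $\mathcal{I}_\mu\ge\frac1{\tilde c}\,\mathcal{U}_q$, and $\mu$ satisfies the isoperimetric inequality $$\mathcal{U}_q(t)\le\tilde c\,\mu^+(A)$$ for all Borel sets $A$ of measure $t=\mu(A)$.
   Context: $d$ is a metric on $\mathbb{R}^N$; $\mu f=\int f\,d\mu$. The length of the gradient of $f:\mathbb{R}^N\to\mathbb{R}$ is related to $d$ by $$|\nabla f|(x)=\limsup_{d(x,y)\downarrow0}\frac{|f(x)-f(y)|}{d(x,y)} .$$ The surface measure of a Borel set $A$ is $\mu^+(A)=\liminf_{\varepsilon\downarrow0}\frac{\mu(A^\varepsilon\setminus A)}{\varepsilon}$, where $A^\varepsilon=\{x:d(x,A)<\varepsilon\}$. The isoperimetric profile $\mathcal{I}_\mu:[0,1]\to\mathbb{R}^+$ is $\mathcal{I}_\mu(t)=\inf\{\mu^+(A):A\text{ Borel},\ \mu(A)=t\}$, with $\mathcal{I}_\mu(0)=\mathcal{I}_\mu(1)=0$. For $q>1$ and $p$ with $\frac1p+\frac1q=1$, $\mathcal{U}_q=f_p\circ F_p^{-1}$, where $f_p(x)=e^{-|x|^p}/Z_p$ is the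 density of a probability measure on $\mathbb{R}$ and $F_p$ is its distribution function, $F_p'=f_p$ (and $\mathcal{U}_q(0)=\mathcal{U}_q(1)=0$). It is known that $\mathcal{U}_q$ is symmetric about $\frac12$ and that for some $L_q>0$ and all $t\in[0,1]$, $\frac1{L_q}G(\min(t,1-t))\le\mathcal{U}_q(t)\le L_qG(\min(t,1-t))$, where $G(t)=t\left(\log\frac1t\right)^{1/q}$. The function $\mathcal{U}_q$ is defined only for $q>1$, so the assertions about $\mathcal{U}_q$ have content for $q>1$, i.e. $\beta<1$. *)

(* Defs.v *)
From HB Require Import structures.
From mathcomp Require Import all_boot all_order all_algebra.
From mathcomp Require Import all_classical all_reals all_analysis.

Set Implicit Arguments.
Unset Strict Implicit.
Unset Printing Implicit Defensive.

Import Order.TTheory GRing.Theory Num.Theory.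
Import numFieldNormedType.Exports.

Local Open Scope classical_set_scope.
Local Open Scope ring_scope.

(* Nonnegativity of the distance follows from the fields. *)
Record metric (R : realType) (T : Type) := Metric {
  metric_fun :> T -> T -> R ;
  metric_fun_xx : forall x, metric_fun x x = 0 ;
  metric_fun_eq : forall x y, metric_fun x y = 0 -> x = y ;
  metric_fun_sym : forall x y, metric_fun x y = metric_fun y x ;
  metric_fun_triangle :
    forall y x z, metric_fun x z <= metric_fun x y + metric_fun y z }.

(* R^N with the topology of d; d need not be related to the usual topology
   carried by 'rV[R]_N, so an alias of the carrier is used. *)
Definition metric_space (R : realType) (N : nat) (d : metric R 'rV[R]_N) :=
  'rV[R]_N.

HB.instance Definition _ (R : realType) (N : nat) (d : metric R 'rV[R]_N) :=
  Pointed.copy (metric_space d) 'rV[R]_N.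
HB.instance Definition _ (R : realType) (N : nat) (d : metric R 'rV[R]_N) :=
  isMetric.Build R (metric_space d)
    (metric_fun_xx d) (@metric_fun_eq _ _ d) (metric_fun_sym d) (metric_fun_triangle d).

Notation borel T := (g_sigma_algebraType (@open T)).

Section metric_measure_space.
Context {R : realType} {N : nat} {d : metric R 'rV[R]_N}.
Local Notation T := (metric_space d).
Implicit Types (f : T -> R) (x y z : T) (A : set T).

Definition locally_lipschitz f := forall x, exists (k : R) (V : set T),
  nbhs x V /\ forall y z, V y -> V z -> `|f y - f z| <= k * d y z.

(* The maximum with 0 only matters at isolated points of T, where the limsup
   over the empty punctured neighbourhood is -oo. *)
Definition grad_length f x : \bar R :=
  maxe 0%E (limf_esup (fun y => (`|f x - f y| / d x y)%:E) x^').

Definition dist_to A x : \bar R := ereal_inf [set (d x a)%:E | a in A].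

Definition enlargement A (e : R) : set T := [set x | (dist_to A x < e%:E)%E].

Variable mu : probability (borel T) R.

Definition non_atomic := forall A : set (borel T), measurable A ->
  (0 < mu A)%E -> exists B : set (borel T),
    [/\ measurable B, B `<=` A & (0 < mu B < mu A)%E].

Definition surface_measure A : \bar R :=
  limf_einf (fun e : R => mu (enlargement A e `\` A) * (e^-1)%:E)%E 0^'+.

Definition isoperimetric_profile (t : R) : \bar R :=
  if (t == 0) || (t == 1) then 0%E
  else ereal_inf [set surface_measure A |
         A in [set A : set (borel T) | measurable A /\ mu A = t%:E]].

End metric_measure_space.

Definition Phi (R : realType) (beta x : R) : R := x * (ln (1 + x)) `^ beta.

Section model_profile.
Context {R : realType}.
Local Notation leb := (@lebesgue_measure R).

Definition Z_ (p : R) : R := \int[leb]_x expR (- (`|x| `^ p)).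

Definition f_ (p x : R) : R := expR (- (`|x| `^ p)) / Z_ p.

Definition F_ (p x : R) : R := \int[leb]_(y in `]-oo, x]) f_ p y.

Definition conj_exponent (q : R) : R := (1 - q^-1)^-1.

(* Meaningful for q > 1; F_ p is then a bijection from R onto ]0, 1[. *)
Definition U_ (q t : R) : R :=
  let p := conj_exponent q in
  if 0 < t < 1 then f_ p ('pinv_(fun=> 0) setT (F_ p) t) else 0.

End model_profile.

(* Main.v *)
Require Import Defs.
From mathcomp Require Import all_boot all_order all_algebra.
From mathcomp Require Import all_classical all_reals all_analysis.
From mathcomp Require Import measurable_realfun ring lra.

(* Apply the hypothesis to [l * g], where [g] is a Lipschitz cutoff equal to 1
   near [A] and to 0 away from it, whose gradient is bounded by [2 / e] and
   supported in [A^e \ A]. With [w = mu A] and [l = 1 / w] the left-hand side is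
   about [w * (ln (1 + 1 / w) `^ beta - ln 2 `^ beta)], hence of the order of
   [w * ln (1 + 1 / w) `^ beta] for [w <= 1 / 2], and the right-hand side is a
   multiple of [mu (A^e \ A) / e]. When [mu A > 1 / 2] use [1 - g] in place of
   [g], with [w = 1 - mu A]. The profile [U_q] is compared with
   [w * ln (1 + 1 / w) `^ beta] by elementary estimates of the two tails of
   [f_p]. *)

Set Implicit Arguments.
Unset Strict Implicit.
Unset Printing Implicit Defensive.

Import Order.TTheory GRing.Theory Num.Theory.
Import numFieldNormedType.Exports.

Local Open Scope classical_set_scope.
Local Open Scope ring_scope.

(** * Power inequalities *)

Section powR.
Context {R : realType}.
Implicit Types a b p x : R.

(** With [q = 1 / beta], this [p] is the conjugate exponent of [q]. *)
Definition conj_exponents (beta p : R) :=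
  [/\ 0 < beta, beta < 1 & p = (1 - beta)^-1].

Lemma ge1_lerBr1_powR p x : 1 <= p -> 0 <= x -> x - 1 <= x `^ p.
Proof.
move=> p1 x0; have [x1|x1] := leP 1 x.
  by rewrite (le_trans _ (le1r_powR x1 p1))// lerBlDr lerDl.
by rewrite (le_trans _ (powR_ge0 _ _))// subr_le0 ltW.
Qed.

Lemma powR1D_le p x : 0 <= p -> 0 <= x -> (1 + x) `^ p <= 2 `^ p * (1 + x `^ p).
Proof.
move=> p0 x0; have [x1|x1] := leP x 1.
- apply: (@le_trans _ _ (2 `^ p)).
    by apply: ge0_ler_powR => //; rewrite ?nnegrE; lra.
  by rewrite ler_peMr ?powR_ge0// lerDl powR_ge0.
- apply: (@le_trans _ _ ((2 * x) `^ p)).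
    by apply: ge0_ler_powR => //; rewrite ?nnegrE; lra.
  by rewrite powRM// ler_wpM2l ?powR_ge0// lerDr.
Qed.

Variables beta p : R.
Hypothesis hp : conj_exponents beta p.

(** Hence a power [p - 1] is a power [p] followed by a power [beta], which is how [beta] enters the
    bound on [U_]. *)
Lemma conj_powR_exponent : p - 1 = p * beta.
Proof.
case: hp => [beta0 beta1 pE]; have : 1 - beta != 0 by apply/eqP; lra.
by rewrite pE => ?; field.
Qed.

Lemma conj_powR_gt1 : 1 < p.
Proof. by case: hp => [beta0 beta1 pE]; rewrite pE invf_gt1; lra. Qed.

(* Young's inequality in the form of the tangent-line bound for the convex
   function [x |-> x `^ p]. *)
Lemma powRB_le a b : 0 <= a -> 0 <= b ->
  b `^ p - a `^ p <= p * b `^ (p - 1) * (b - a).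
Proof.
move=> a0 b0; have p1 := conj_powR_gt1; have [beta0 beta1 pE] := hp.
have /= := @conjugate_powR R a (b `^ (p - 1)) p beta^-1 a0 (powR_ge0 _ _).
rewrite invrK invr_gt0 -powRrM conj_powR_exponent mulfK; last by lra.
rewrite -conj_powR_exponent.
have pV : p^-1 + beta = 1 by rewrite pE invrK; lra.
have p0 : 0 < p by lra.
move=> /(_ p0 beta0 pV).
have -> : beta = 1 - p^-1 by lra.
rewrite -(ler_pM2l p0).
have -> : p * (a `^ p / p + b `^ p * (1 - p^-1)) = a `^ p + (p - 1) * b `^ p.
  by field; lra.
have := mulr_powRB1 b0 p0; move: (b `^ (p - 1)) => c <-; lra.
Qed.

(** Since [d <= 1], the slope of [x^p] at [a + d] is at most [p (1 + a)^(p - 1) = p / d]. The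
    density thus loses at most a factor [expR p] from [a] to [a + d]. *)
Lemma powR_addV_le a (d := ((1 + a) `^ (p - 1))^-1) : 0 <= a ->
  (a + d) `^ p <= a `^ p + p.
Proof.
move=> a0; have p1 := conj_powR_gt1.
have d0 : 0 < d by rewrite invr_gt0 powR_gt0; lra.
have d1 : d <= 1.
  rewrite invf_le1 ?powR_gt0; [|lra..].
  by rewrite -[leLHS](powRr0 (1 + a)) ler_powR; lra.
rewrite -lerBlDl (le_trans (powRB_le _ _))//; [lra|].
rewrite addrAC subrr add0r -mulrA ler_piMr//; [lra|].
have c0 : 0 < (1 + a) `^ (p - 1) by rewrite powR_gt0; lra.
rewrite -[leRHS](divff (lt0r_neq0 c0)) ler_pM2r ?invr_gt0//.
by apply: ge0_ler_powR; rewrite ?nnegrE; lra.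
Qed.

End powR.

(** * Real integrals and integrability of the unnormalised density *)

Section Rintegral.
Context {d : measure_display} {T : measurableType d} {R : realType}.
Variable mu : {measure set T -> \bar R}.
Implicit Types (A B : set T) (f : T -> R).

Lemma Rintegral_ge_cst A (c : R) f : measurable A -> (mu A < +oo)%E ->
  mu.-integrable A (EFin \o f) -> (forall x, A x -> c <= f x) ->
  c * fine (mu A) <= \int[mu]_(x in A) f x.
Proof.
move=> mA Aoo fi cf; rewrite -Rintegral_cst//; apply: le_Rintegral => //.
by apply: measurable_bounded_integrable => //; exact: bounded_cst.
Qed.

Lemma Rintegral_le_cst A (c : R) f : measurable A -> (mu A < +oo)%E ->
  mu.-integrable A (EFin \o f) -> (forall x, A x -> f x <= c) ->
  \int[mu]_(x in A) f x <= c * fine (mu A).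
Proof.
move=> mA Aoo fi cf; rewrite -Rintegral_cst//; apply: le_Rintegral => //.
by apply: measurable_bounded_integrable => //; exact: bounded_cst.
Qed.

Lemma ge0_subset_Rintegral A B f : measurable A -> measurable B ->
  mu.-integrable B (EFin \o f) -> (forall x, B x -> 0 <= f x) -> A `<=` B ->
  \int[mu]_(x in A) f x <= \int[mu]_(x in B) f x.
Proof.
move=> mA mB fi f0 AB; have fiA := integrableS mB mA AB fi.
rewrite fine_le ?integrable_fin_num//.
by apply: ge0_subset_integral => //; exact: measurable_int fi.
Qed.

End Rintegral.

Section exp_powR.
Context {R : realType}.
Local Notation leb := (@lebesgue_measure R).
Implicit Types (p x : R).

Lemma measurable_exp_normr_powR p (k : R) :
  measurable_fun [set: R] (fun x => expR (- (`|x| `^ p) * k)).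
Proof.
apply: measurableT_comp => //; apply: measurable_funM => //.
apply: measurableT_comp => //.
by apply: (@measurableT_comp _ _ _ _ _ _ (@powR R ^~ p) _ (@Num.norm R R)).
Qed.

Lemma integrable_exp_normr :
  leb.-integrable setT (EFin \o (fun x : R => expR (- `|x| * 2^-1))).
Proof.
have mf : measurable_fun [set: R] (fun x => expR (- `|x| * 2^-1)).
  apply: measurableT_comp => //; apply: measurable_funM => //.
  by apply: measurableT_comp.
apply/integrableP; split; first exact/measurable_EFinP.
under eq_integral do rewrite /= ger0_norm ?expR_ge0//.
rewrite ge0_symfun_integralT; last 3 first.
- by move=> x; exact: expR_ge0.
- move=> x; apply: continuous_comp; last exact: continuous_expR.
  apply: continuousM; last exact: cst_continuous.
  by apply: continuousN; exact: norm_continuous.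
- by move=> x /=; rewrite normrN.
(* One factor 2 comes from the symmetry, the other from [expR (- x / 2)] being twice the exponential
   density of rate 1 / 2. *)
apply: (@le_lt_trans _ _ (2%:E * (2%:E * 1))%E); last by rewrite -!EFinM ltry.
rewrite lee_wpmul2l//.
have r0 : 0 < 2^-1 :> R by rewrite invr_gt0.
rewrite -(integral_exponential_pdf r0).
have mpdf := @measurable_exponential_pdf R 2^-1.
have pdf0 := @exponential_pdf_ge0 R 2^-1 (ltW r0).
rewrite -ge0_integralZl//; last 2 first.
- exact/measurable_EFinP.
- by move=> x _; rewrite lee_fin.
rewrite (_ : [set x | _] = `[0, +oo[%classic); last by rewrite set_itvcy.
rewrite [leLHS]integral_mkcond.
apply: ge0_le_integral => //.
- by move=> x _; apply: erestrict_ge0 => y _; rewrite lee_fin expR_ge0.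
- apply/(measurable_restrictT _ _).1.
    exact: measurable_itv.
  by apply/measurable_EFinP; exact: measurable_funTS.
- by apply: measurable_funeM; exact/measurable_EFinP.
- move=> x _; rewrite patchE; case: ifPn => [|_].
    rewrite inE/= in_itv/= andbT => x0.
    rewrite lee_fin exponential_pdfE// ger0_norm//.
    by rewrite mulrA mulfV// mul1r mulNr mulrC mulNr.
  by rewrite mule_ge0// lee_fin.
Qed.

(** Dominated by a multiple of [expR (- |x| / 2)], since [|x| - 1 <= |x|^p]. *)
Lemma integrable_exp_half_powR p : 1 <= p ->
  leb.-integrable setT (EFin \o (fun x : R => expR (- (`|x| `^ p) * 2^-1))).
Proof.
move=> p1; have := integrableZl measurableT (expR 2^-1) integrable_exp_normr.
apply: le_integrable => //.
  by apply/measurable_EFinP; exact: measurable_exp_normr_powR.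
move=> x _; rewrite /= lee_fin (ger0_norm (expR_ge0 _)).
rewrite [leRHS]ger0_norm ?mulr_ge0 ?expR_ge0//.
rewrite -expRD ler_expR -[X in X + _]mul1r -mulrDl ler_pM2r ?invr_gt0//.
by rewrite -[leRHS]opprB lerN2; exact: ge1_lerBr1_powR.
Qed.

Lemma integrable_exp_powR p : 1 <= p ->
  leb.-integrable setT (EFin \o (fun x : R => expR (- (`|x| `^ p)))).
Proof.
move=> p1; have := integrable_exp_half_powR p1.
apply: le_integrable => //.
  apply/measurable_EFinP; have := measurable_exp_normr_powR p 1.
  by under eq_fun do rewrite mulr1.
move=> x _; rewrite /= lee_fin !(ger0_norm (expR_ge0 _))// ler_expR.
by have := powR_ge0 `|x| p; lra.
Qed.

Lemma Z_gt0 p : 1 <= p -> 0 < Z_ p.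
Proof.
move=> p1; have fi := integrable_exp_powR p1.
have p0 : 0 <= p by lra.
have l01 : leb `[0, 1] = 1%E.
  by rewrite lebesgue_measure_itv/= lte_fin ltr01 -EFinB subr0.
have l01y : (leb `[0%R, 1%R] < +oo)%E by rewrite l01 ltry.
have fi01 : leb.-integrable `[0, 1] (EFin \o (fun x => expR (- (`|x| `^ p)))).
  by apply: integrableS fi => //; exact: measurable_itv.
apply: (@lt_le_trans _ _ (expR (-1) * fine (leb `[0, 1]))).
  by rewrite l01 mulr1 expR_gt0.
apply: (le_trans (Rintegral_ge_cst _ _ fi01 _)).
- exact: measurable_itv.
- exact: l01y.
- move=> x /=; rewrite in_itv/= => /andP[x0 x1]; rewrite ler_expR lerN2.
  rewrite ger0_norm// -[leRHS](congr1 (@^~ p) (@powR1 R)).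
  by apply: ge0_ler_powR; rewrite ?nnegrE.
- by apply: ge0_subset_Rintegral => // x _; exact: expR_ge0.
Qed.

End exp_powR.

(** * The model distribution *)

Section model_distribution.
Context {R : realType}.
Local Notation leb := (@lebesgue_measure R).
Implicit Types (p x y a : R).

Lemma f_ge0 p x : 1 <= p -> 0 <= f_ p x.
Proof. by move=> p1; rewrite divr_ge0 ?expR_ge0// ltW ?Z_gt0. Qed.

Lemma f_le p x : 1 <= p -> f_ p x <= (Z_ p)^-1.
Proof.
by move=> p1; rewrite ler_piMl ?invr_ge0 ?(ltW (Z_gt0 p1)).
Qed.

Lemma integrable_f p (B : set R) : 1 <= p -> measurable B ->
  leb.-integrable B (EFin \o f_ p).
Proof.
move=> p1 mB; apply: (@integrableS _ _ _ _ setT) => //.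
have := integrableZr measurableT (Z_ p)^-1 (integrable_exp_powR p1).
by apply: eq_integrable.
Qed.

Lemma Rintegral_f p : 1 <= p -> \int[leb]_x f_ p x = 1.
Proof.
move=> p1; have Z0 := Z_gt0 p1.
rewrite RintegralZr//; last exact: integrable_exp_powR.
by rewrite divff// gt_eqF.
Qed.

Lemma F_B p x y : 1 <= p -> x <= y ->
  F_ p y - F_ p x = \int[leb]_(t in `]x, y]) f_ p t.
Proof.
move=> p1 xy; rewrite /F_ Rintegral_itvB//.
by apply: integrable_f => //; exact: measurable_itv.
Qed.

Lemma onem_F p x : 1 <= p ->
  1 - F_ p x = \int[leb]_(t in `]x, +oo[) f_ p t.
Proof.
move=> p1; rewrite -(Rintegral_f p1) -set_itvNyy Rintegral_itvB//.
by apply: integrable_f => //; exact: measurable_itv.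
Qed.

Lemma Rintegral_f_itv_le p x y : 1 <= p -> x <= y ->
  \int[leb]_(t in `]x, y]) f_ p t <= (Z_ p)^-1 * (y - x).
Proof.
move=> p1 xy.
have lxy : leb `]x, y] = (y - x)%:E.
  rewrite lebesgue_measure_itv/= lte_fin -EFinB.
  by have [//|yx] := ltP x y; rewrite (@le_anti _ _ x y) ?xy// subrr.
have lxyy : (leb `]x, y] < +oo)%E by rewrite lxy ltry.
rewrite -[y - x]/(fine (y - x)%:E) -lxy; apply: Rintegral_le_cst => //.
- by apply: integrable_f => //; exact: measurable_itv.
- by move=> t _; exact: f_le.
Qed.

(** The density is at most [1 / Z_ p], so [F_ p] is Lipschitz. *)
Lemma F_continuous p : 1 <= p -> continuous (F_ p).
Proof.
move=> p1 x; apply/cvgrPdist_le => e e0.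
have Z0 := Z_gt0 p1.
have lip y z : y <= z -> `|F_ p y - F_ p z| <= (Z_ p)^-1 * `|y - z|.
  move=> yz; rewrite distrC (distrC y) F_B//.
  rewrite [X in _ <= _ * X]ger0_norm ?subr_ge0//.
  rewrite ger0_norm ?Rintegral_f_itv_le// Rintegral_ge0// => t _.
  exact: f_ge0.
near=> y; apply: (@le_trans _ _ ((Z_ p)^-1 * `|x - y|)).
  have [xy|/ltW yx] := leP x y; first exact: lip.
  by rewrite distrC (distrC x); exact: lip.
rewrite mulrC ler_pdivrMr//; near: y.
by apply: cvgr_dist_le => //; exact: mulr_gt0.
Unshelve. all: by end_near. Qed.

(** Half of the exponent of the density is integrated here; the other half is kept as the decay
    [expR (- a^p / 2)] of the tails beyond [a]. *)
Definition tail_cst p :=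
  (\int[leb]_x expR (- (`|x| `^ p) * 2^-1)) / Z_ p.

Lemma Rintegral_f_tail p (B : set R) a : 1 <= p -> measurable B -> 0 <= a ->
  (forall y, B y -> a <= `|y|) ->
  \int[leb]_(t in B) f_ p t <= tail_cst p * expR (- (a `^ p) * 2^-1).
Proof.
move=> p1 mB a0 aB; have Z0 := Z_gt0 p1.
have hi := integrable_exp_half_powR p1.
have hiB : leb.-integrable B (EFin \o (fun x => expR (- (`|x| `^ p) * 2^-1))).
  exact: integrableS hi.
set k := (Z_ p)^-1 * expR (- (a `^ p) * 2^-1).
apply: (@le_trans _ _ (\int[leb]_(t in B) (k * expR (- (`|t| `^ p) * 2^-1)))).
  apply: le_Rintegral => //.
  - exact: integrable_f.
  - by have := @integrableZl _ _ _ leb _ mB k _ hiB; apply: eq_integrable.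
  - move=> t /aB at_; rewrite /f_ /k mulrC -mulrA ler_pM2l ?invr_gt0//.
    rewrite -expRD ler_expR -mulrDl.
    have : a `^ p <= `|t| `^ p.
      by apply: ge0_ler_powR => //; rewrite ?nnegrE //; lra.
    lra.
rewrite RintegralZl// /k /tail_cst.
rewrite mulrAC ler_pM2r ?expR_gt0// mulrC ler_pM2r ?invr_gt0//.
by apply: ge0_subset_Rintegral => // t _; exact: expR_ge0.
Qed.

(** For [a = 0] and [B] the whole line, the tail bound majorises the total mass 1. *)
Lemma tail_cst_gt0 p : 1 <= p -> 0 < tail_cst p.
Proof.
move=> p1; have /= := @Rintegral_f_tail p setT 0 p1 measurableT (lexx _).
rewrite Rintegral_f// => /(_ (fun y _ => normr_ge0 y)) /(lt_le_trans ltr01).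
by rewrite pmulr_lgt0// expR_gt0.
Qed.

Lemma exists_tail_le p (e : R) : 1 <= p -> 0 < e ->
  exists2 x, 0 <= x & tail_cst p * expR (- (x `^ p) * 2^-1) <= e.
Proof.
move=> p1 e0; have D0 := tail_cst_gt0 p1.
set D := tail_cst p in D0 *.
have De0 : 0 < D / e by exact: divr_gt0.
(* For this [x >= 1], [expR (x^p / 2) >= 1 + x / 2 >= D / e]. *)
exists (1 + 2 * (D / e)); first lra.
set x := 1 + _; have x1 : 1 <= x by rewrite /x; lra.
have xp : x <= x `^ p by exact: le1r_powR.
rewrite mulNr expRN ler_pdivrMr ?expR_gt0// -ler_pdivrMl//.
rewrite (le_trans _ (expR_ge1Dx _))// mulrC.
by move: xp; rewrite /x; lra.
Qed.

Lemma F_le_tail p x : 1 <= p -> x <= 0 ->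
  F_ p x <= tail_cst p * expR (- (`|x| `^ p) * 2^-1).
Proof.
move=> p1 x0; apply: Rintegral_f_tail => // t /=.
by rewrite in_itv/= => tx; rewrite !ler0_norm ?lerN2// (le_trans tx).
Qed.

Lemma onem_F_le_tail p x : 1 <= p -> 0 <= x ->
  1 - F_ p x <= tail_cst p * expR (- (`|x| `^ p) * 2^-1).
Proof.
move=> p1 x0; rewrite onem_F//; apply: Rintegral_f_tail => // t /=.
by rewrite in_itv/= andbT => /ltW xt; rewrite !ger0_norm// (le_trans x0).
Qed.

(** Intermediate values between a point whose left tail is at most [t] and one whose right tail is
    at most [1 - t]. *)
Lemma F_surj p t : 1 <= p -> 0 < t < 1 -> exists x, F_ p x = t.
Proof.
move=> p1 /andP[t0 t1].
have [x x0 xt] := exists_tail_le p1 t0.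
have t1' : 0 < 1 - t by rewrite subr_gt0.
have [y y0 yt] := exists_tail_le p1 t1'.
have Fx : F_ p (- x) <= t.
  apply: le_trans xt; rewrite -{2}(ger0_norm x0) -normrN.
  by apply: F_le_tail; rewrite ?oppr_le0.
have Fy : t <= F_ p y.
  suff : 1 - F_ p y <= 1 - t by lra.
  by apply: le_trans yt; rewrite -{2}(ger0_norm y0); exact: onem_F_le_tail.
have xy : - x <= y by lra.
have [] := @IVT R (F_ p) (- x) y t xy.
- by apply: continuous_subspaceT; exact: F_continuous.
- by rewrite ge_min le_max Fx Fy orbT.
- by move=> z _ <-; exists z.
Qed.

(** By [powR_addV_le] the density is at least [expR (- p) * f_ p a] on an interval of length [d]
    inside [B]; multiplying by [d] bounds the mass of [B] from below. *)
Lemma f_le_Rintegral (beta p : R) (B : set R) a x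
    (d := ((1 + `|a|) `^ (p - 1))^-1) :
  conj_exponents beta p ->
  measurable B -> `]x, (x + d)] `<=` B ->
  (forall t, x < t <= x + d -> `|t| <= `|a| + d) ->
  f_ p a <= expR p * (1 + `|a|) `^ (p - 1) * \int[leb]_(t in B) f_ p t.
Proof.
move=> hp mB xB xt; have p1 := ltW (conj_powR_gt1 hp).
have Z0 := Z_gt0 p1.
have c0 : 0 < (1 + `|a|) `^ (p - 1) by rewrite powR_gt0// ltr_pwDl.
have d0 : 0 < d by rewrite invr_gt0.
have lx : leb `]x, (x + d)] = d%:E.
  by rewrite lebesgue_measure_itv/= lte_fin ltrDl d0 -EFinB addrAC subrr add0r.
have lxy : (leb `]x, (x + d)%R] < +oo)%E by rewrite lx ltry.
have -> : f_ p a = expR p * (1 + `|a|) `^ (p - 1) * (expR (- p) * f_ p a * d).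
  by rewrite expRN /d; field; rewrite !gt_eqF// expR_gt0.
rewrite ler_pM2l ?mulr_gt0 ?expR_gt0//.
apply: (@le_trans _ _ (\int[leb]_(t in `]x, (x + d)]) f_ p t)); last first.
  apply: ge0_subset_Rintegral => //; first exact: integrable_f.
  by move=> t _; exact: f_ge0.
have -> : expR (- p) * f_ p a * d =
    expR (- p) * f_ p a * fine (leb `]x, (x + d)]) by rewrite lx.
apply: Rintegral_ge_cst => //.
  by apply: integrable_f => //; exact: measurable_itv.
move=> t /=; rewrite in_itv/= => /xt tad.
rewrite mulrA -expRD ler_pM2r ?invr_gt0// ler_expR.
rewrite -opprD lerN2 addrC.
apply: le_trans (powR_addV_le hp (normr_ge0 a)).
by apply: ge0_ler_powR => //; rewrite ?nnegrE ?addr_ge0// ?(ltW d0)//; lra.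
Qed.

Lemma f_le_F (beta p : R) x : conj_exponents beta p ->
  f_ p x <= expR p * (1 + `|x|) `^ (p - 1) * F_ p x.
Proof.
move=> hp; set d := ((1 + `|x|) `^ (p - 1))^-1.
have d0 : 0 < d by rewrite invr_gt0 powR_gt0// ltr_pwDl.
(* The interval of length [d] ending at [- |x|] lies to the left of [x] whatever the sign of [x]. *)
apply: (@f_le_Rintegral _ _ _ _ (- `|x| - d) hp) => //.
- rewrite subrK => t /=; rewrite !in_itv/= => /andP[_ tx].
  by rewrite (le_trans tx)// lerNl -normrN ler_norm.
- rewrite -/d subrK => t /andP[xt tx].
  by rewrite ler0_norm; have := normr_ge0 x; lra.
Qed.

Lemma f_le_onem_F (beta p : R) x : conj_exponents beta p ->
  f_ p x <= expR p * (1 + `|x|) `^ (p - 1) * (1 - F_ p x).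
Proof.
move=> hp; set d := ((1 + `|x|) `^ (p - 1))^-1.
have d0 : 0 < d by rewrite invr_gt0 powR_gt0// ltr_pwDl.
have p1 := ltW (conj_powR_gt1 hp).
rewrite onem_F//; apply: (@f_le_Rintegral _ _ _ _ `|x| hp) => //.
- move=> t /=; rewrite !in_itv/= andbT => /andP[xt _].
  by rewrite (le_lt_trans (ler_norm x)).
- rewrite -/d => t /andP[xt tx].
  by rewrite ger0_norm; have := normr_ge0 x; lra.
Qed.

End model_distribution.

(** * Upper bound on the model profile *)

Section U_bound.
Context {R : realType}.

(** The function [G] of the known estimate on [U_q], with [1 / m] replaced by [1 + 1 / m] so that
    the logarithm is at least [ln 2] for [m <= 1]. *)
Definition log_profile (beta m : R) : R := m * ln (1 + m^-1) `^ beta.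

Lemma ln2_gt0 : 0 < ln (2 : R).
Proof. by rewrite ln_gt0// ltr1n. Qed.

(** Taking logarithms, [s <= 2 (ln D - ln m)]. Here [- ln m] is below [ln (1 + 1 / m)], and the
    constants are absorbed because this logarithm is at least [ln 2]. *)
Lemma exp_tail_ln_le (D m s : R) : 0 < D -> 0 < m <= 1 -> 0 <= s ->
  m <= D * expR (- s * 2^-1) ->
  1 + s <= ((1 + 2 * `|ln D|) / ln 2 + 2) * ln (1 + m^-1).
Proof.
move=> D0 /andP[m0 m1] s0 mD; have l2 := ln2_gt0.
have L2 : ln 2 <= ln (1 + m^-1).
  rewrite ler_ln ?posrE ?addr_gt0 ?invr_gt0//.
  by rewrite -[leLHS]/(1 + 1) lerD2l invf_ge1.
have Lm : - ln m <= ln (1 + m^-1).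
  by rewrite -lnV ?posrE// ler_ln ?posrE ?addr_gt0 ?invr_gt0// lerDr.
have sD : s * 2^-1 <= ln D - ln m.
  move: mD; rewrite -ler_ln ?posrE ?mulr_gt0 ?expR_gt0//.
  by rewrite lnM ?posrE ?expR_gt0// expRK; lra.
have lnD := ler_norm (ln D).
rewrite mulrDl -mulrA.
have : 1 + 2 * `|ln D| <= (1 + 2 * `|ln D|) * ((ln 2)^-1 * ln (1 + m^-1)).
  by rewrite ler_peMr ?addr_ge0 ?mulr_ge0// mulrC ler_pdivlMr// mul1r.
lra.
Qed.

(* [f_ p x] is at most [(1 + |x|) `^ (p - 1)] times either tail at [x], and the
   smaller tail is exponentially small in [|x| `^ p], whence
   [(1 + |x|) `^ (p - 1)] is of the order of [ln (1 + m^-1) `^ beta]. *)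
Lemma U_le (beta : R) : 0 < beta -> beta < 1 -> exists2 C : R, 0 < C &
  forall t, 0 < t < 1 ->
  U_ beta^-1 t <= C * log_profile beta (Num.min t (1 - t)).
Proof.
move=> beta0 beta1; set p := (1 - beta)^-1.
have hp : conj_exponents beta p by split.
have p1 := ltW (conj_powR_gt1 hp); have p0 := le_trans ler01 p1.
(* The factor [2^p] comes from [powR1D_le], the other from [exp_tail_ln_le] with [D = tail_cst p]
   and [s = |x|^p]. *)
pose K := 2 `^ p * ((1 + 2 * `|ln (tail_cst p)|) / ln 2 + 2).
have K0 : 0 < K.
  rewrite mulr_gt0 ?powR_gt0// ltr_wpDl// divr_ge0 ?addr_ge0 ?mulr_ge0//.
  by rewrite ltW// ln2_gt0.
exists (expR p * K `^ beta); first by rewrite mulr_gt0 ?expR_gt0 ?powR_gt0.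
move=> t t01; rewrite /log_profile; set m := Num.min _ _.
rewrite /U_ t01 /conj_exponent invrK -/p.
set x := 'pinv_ _ _ _ _.
(* As [t] is a value of [F_ p], the default of the partial inverse does not intervene. *)
have Fx : F_ p x = t.
  have [y Fy] := F_surj p1 t01.
  by apply: pinvK; rewrite inE; exists y.
have {t01} /andP[t0 t1] := t01.
have m01 : 0 < m <= 1 by rewrite lt_min ge_min t0 subr_gt0 t1 ltW.
have /andP[m0 m1] := m01.
have fx : f_ p x <= expR p * (1 + `|x|) `^ (p - 1) * m.
  rewrite /m /Num.min; case: ifPn => _.
    by rewrite -Fx; exact: f_le_F hp.
  by rewrite -Fx; exact: f_le_onem_F hp.
have mx : m <= tail_cst p * expR (- (`|x| `^ p) * 2^-1).
  rewrite ge_min -Fx; have [x0|x0] := leP x 0.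
    by rewrite F_le_tail.
  by rewrite onem_F_le_tail ?orbT// ltW.
have Kx : (1 + `|x|) `^ p <= K * ln (1 + m^-1).
  rewrite (le_trans (powR1D_le p0 (normr_ge0 x)))// -mulrA ler_pM2l ?powR_gt0//.
  by apply: exp_tail_ln_le => //; exact: tail_cst_gt0.
have L0 : 0 <= ln (1 + m^-1) by rewrite ln_ge0// lerDl invr_ge0 ltW.
apply: (le_trans fx); rewrite -!mulrA ler_pM2l ?expR_gt0// mulrCA mulrC.
rewrite ler_pM2l// -powRM ?(ltW K0)// (conj_powR_exponent hp) powRrM.
have KL0 := mulr_ge0 (ltW K0) L0.
by apply: ge0_ler_powR; rewrite ?nnegrE ?powR_ge0 ?(ltW beta0).
Qed.

End U_bound.

(** * Lipschitz functions and distance to a set *)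

Section lower_integral.
Context {disp : measure_display} {T : measurableType disp} {R : realType}.
Variable mu : {measure set T -> \bar R}.

(* [grad_length f] need not be measurable, but the integral of a nonnegative
   function is a supremum over the simple functions below it, so monotonicity
   still holds. *)
Lemma ge0_le_lower_integral (f g : T -> \bar R) :
  (forall x, 0 <= f x)%E -> (forall x, f x <= g x)%E ->
  (\int[mu]_x f x <= \int[mu]_x g x)%E.
Proof.
move=> f0 fg; rewrite !ge0_integralTE//; last first.
  by move=> x; exact: le_trans (fg x).
apply: le_ereal_sup => _ /= [h hf <-]; exists h => // x.
exact: le_trans (fg x).
Qed.

End lower_integral.

Section metric_space_theory.
Context {R : realType} {N : nat} {d : metric R 'rV[R]_N}.
Local Notation T := (metric_space d).
Implicit Types (f : T -> R) (x y z : T) (A : set T) (k : R).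

Lemma metric_fun_ge0 x y : 0 <= d x y.
Proof.
have := metric_fun_triangle d y x x.
by rewrite metric_fun_xx (metric_fun_sym d y x); lra.
Qed.

Lemma metric_ballE x (e : R) : ball x e = [set y | d x y < e].
Proof. by []. Qed.

Definition lipschitz_with k f := forall x y, `|f x - f y| <= k * d x y.

Lemma lipschitz_with_locally k f : lipschitz_with k f -> locally_lipschitz f.
Proof.
move=> lf x; exists k, setT; split => //.
exact: (@filterT _ _ (@nbhs_filter T x)).
Qed.

Lemma lipschitz_with_continuous k f :
  0 < k -> lipschitz_with k f -> continuous f.
Proof.
move=> k0 lf x; apply/(@cvgrPdist_lt _ R^o T (nbhs x)) => e e0.
apply/nbhs_ballP; exists (e / k) => /=; first exact: divr_gt0.
move=> y; rewrite metric_ballE /= ltr_pdivlMr// mulrC.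
exact/le_lt_trans/lf.
Qed.

Lemma continuous_borel_measurable f : continuous f ->
  measurable_fun [set: borel T] (f : borel T -> R).
Proof.
move=> cf _; apply: (measurability _ (RGenOInfty.measurableE R)) => //.
move=> /= _ [_ [a ->] <-]; rewrite setTI; apply: sub_sigma_algebra.
by apply: open_comp => // x _; exact: cf.
Qed.

Lemma grad_length_ge0 f x : (0 <= grad_length f x)%E.
Proof. by rewrite le_max lexx. Qed.

(** The limsup is at most the supremum over one punctured neighbourhood; [0 <= k] handles the
    maximum with 0. *)
Lemma grad_length_le f x k (V : set T) : 0 <= k -> nbhs x V ->
  (forall y, V y -> `|f x - f y| <= k * d x y) -> (grad_length f x <= k%:E)%E.
Proof.
move=> k0 xV fV; rewrite ge_max lee_fin k0 /= limf_esupE.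
pose W := V `&` [set y | y <> x].
apply: (@le_trans _ _ (ereal_sup
    [set (`|f x - f y| / d x y)%:E | y in W])).
  apply: ereal_inf_lbound; exists W => //.
  by apply: filterS xV => y Vy /= yx; split => //; exact/eqP.
apply: ge_ereal_sup => _ /= [y [Vy yx] <-]; rewrite lee_fin.
have dxy : 0 < d x y.
  rewrite lt_neqAle metric_fun_ge0 andbT eq_sym; apply: contra_not_neq yx.
  by move=> /(@metric_fun_eq _ _ d) ->.
by rewrite ler_pdivrMr// fV.
Qed.

Section distance_to_set.
Variables (A : set T) (a0 : T).
Hypothesis Aa0 : A a0.

Lemma dist_to_fin_num x : dist_to A x \is a fin_num.
Proof.
rewrite ge0_fin_numE.
  apply: (@le_lt_trans _ _ (d x a0)%:E); last exact: ltry.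
  by apply: ereal_inf_lbound; exists a0.
by apply: le_ereal_inf_tmp => _ /= [y _ <-]; rewrite lee_fin metric_fun_ge0.
Qed.

(** The infimum is finite because [A] contains [a0], so [fine] returns the true distance. *)
Definition dist_fun x : R := fine (dist_to A x).

Lemma dist_funE x : (dist_fun x)%:E = dist_to A x.
Proof. by rewrite fineK// dist_to_fin_num. Qed.

Lemma dist_fun_ge0 x : 0 <= dist_fun x.
Proof.
rewrite -lee_fin dist_funE; apply: le_ereal_inf_tmp => _ /= [y _ <-].
by rewrite lee_fin metric_fun_ge0.
Qed.

Lemma dist_fun_le x a : A a -> dist_fun x <= d x a.
Proof.
by move=> Aa; rewrite -lee_fin dist_funE; apply: ereal_inf_lbound; exists a.
Qed.

Lemma dist_fun_mem x : A x -> dist_fun x = 0.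
Proof.
move=> Ax; apply/eqP; rewrite eq_le dist_fun_ge0 andbT.
by rewrite -(metric_fun_xx d x) dist_fun_le.
Qed.

Lemma dist_fun_triangle x y : dist_fun x <= d x y + dist_fun y.
Proof.
rewrite -lerBlDl -lee_fin dist_funE; apply: le_ereal_inf_tmp => _ /= [a Aa <-].
rewrite lee_fin lerBlDl (le_trans (dist_fun_le _ Aa))//.
exact: metric_fun_triangle.
Qed.

Lemma dist_fun_lipschitz : lipschitz_with 1 dist_fun.
Proof.
move=> x y; rewrite mul1r ler_norml; apply/andP; split.
  by rewrite lerNl opprB lerBlDr metric_fun_sym dist_fun_triangle.
by rewrite lerBlDr dist_fun_triangle.
Qed.

Lemma enlargementE e : enlargement A e = [set x | dist_fun x < e].
Proof.
by apply/seteqP; split => x; rewrite /enlargement /= -dist_funE lte_fin.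
Qed.

Lemma dist_fun_continuous : continuous dist_fun.
Proof. exact: lipschitz_with_continuous ltr01 dist_fun_lipschitz. Qed.

Lemma nbhs_dist_fun_lt x e : dist_fun x < e -> nbhs x [set y | dist_fun y < e].
Proof.
by move=> xe; exact: (@dist_fun_continuous x _ (lt_nbhsl xe)).
Qed.

Lemma nbhs_dist_fun_gt x e : e < dist_fun x -> nbhs x [set y | e < dist_fun y].
Proof.
by move=> xe; exact: (@dist_fun_continuous x _ (lt_nbhsr xe)).
Qed.

Lemma enlargement_measurable e : measurable (enlargement A e : set (borel T)).
Proof.
rewrite enlargementE; apply: sub_sigma_algebra.
by rewrite openE => x /=; exact: nbhs_dist_fun_lt.
Qed.

End distance_to_set.

End metric_space_theory.

(** * The hypothesis applied to cutoff functions *)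

Section Phi_clamp.
Context {R : realType}.
Implicit Types beta x y : R.

Lemma Phi_ge0 beta x : 0 <= x -> 0 <= Phi beta x.
Proof. by move=> x0; rewrite mulr_ge0// powR_ge0. Qed.

Lemma Phi_le beta x y : 0 <= beta -> 0 <= x -> x <= y ->
  Phi beta x <= Phi beta y.
Proof.
move=> b0 x0 xy; have y0 := le_trans x0 xy.
rewrite ler_pM ?powR_ge0//; apply: ge0_ler_powR => //.
- by rewrite nnegrE ln_ge0// lerDl.
- by rewrite nnegrE ln_ge0// lerDl.
- by rewrite ler_ln ?posrE ?lerD2l// ltr_pwDl.
Qed.

Definition clamp x : R := Num.min 1 (Num.max 0 x).

Lemma clamp_ge0 x : 0 <= clamp x.
Proof. by rewrite le_min ler01 le_max lexx. Qed.

Lemma clamp_le1 x : clamp x <= 1.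
Proof. by rewrite ge_min lexx. Qed.

Lemma clamp_eq1 x : 1 <= x -> clamp x = 1.
Proof. by move=> x1; apply: min_l; rewrite le_max x1 orbT. Qed.

Lemma clamp_eq0 x : x <= 0 -> clamp x = 0.
Proof. by move=> x0; rewrite /clamp (max_l x0) min_r. Qed.

Lemma clamp_lipschitz x y : `|clamp x - clamp y| <= `|x - y|.
Proof.
wlog xy : x y / x <= y => [th|].
  have [/th//|/ltW/th] := leP x y.
  by rewrite distrC (distrC y).
rewrite (distrC x) (distrC (clamp x)) [leRHS]ger0_norm ?subr_ge0//.
have [x1|x1] := leP 1 x.
  by rewrite !clamp_eq1 ?(le_trans x1)// subrr normr0 subr_ge0.
have [y0|y0] := leP y 0.
  by rewrite !clamp_eq0 ?(le_trans xy)// subrr normr0 subr_ge0.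
rewrite /clamp (max_r (ltW y0)) ger0_norm.
  rewrite /Num.min /Num.max; do !case: ifPn; rewrite -?leNgt; lra.
rewrite /Num.min /Num.max; do !case: ifPn; rewrite -?leNgt; lra.
Qed.

End Phi_clamp.

Section test_function.
Context {R : realType} {N : nat} {d : metric R 'rV[R]_N}.
Local Notation T := (metric_space d).
Variable mu : probability (borel T) R.
Variables beta c : R.

(** Integrability of [f] makes the real integral inside [Phi] the true mean of [|f|] rather than a
    default value. *)
Definition Phi_inequality := forall f : T -> R,
  locally_lipschitz f -> mu.-integrable setT (EFin \o f) ->
  (\int[mu]_x (Phi beta `|f x|)%:E - (Phi beta (\int[mu]_x `|f x|)%R)%:E
   <= c%:E * \int[mu]_x grad_length f x)%E.

Local Notation P X := (fine (mu X)).

Lemma integral_patch_cst (E : set (borel T)) (k : R) : measurable E ->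
  (\int[mu]_x ((cst k%:E) \_ E) x)%E = (k * P E)%:E.
Proof.
move=> mE; rewrite -integral_mkcond integral_cst// EFinM fineK//.
exact: fin_num_measure.
Qed.

Variables (A : set T) (a0 : T).
Hypotheses (mA : measurable (A : set (borel T))) (Aa0 : A a0).
Local Notation h := (dist_fun A).

(** [F] is constant on two open sets, one containing [A] and the other the complement of [A^e], so
    its gradient vanishes off the shell; on the shell it is at most [k]. *)
Lemma integral_grad_length_le (F : T -> R) (e k : R) : 0 < e -> 0 <= k ->
  lipschitz_with k F ->
  (forall x y, h x < e / 4 -> h y < e / 4 -> F x = F y) ->
  (forall x y, 3 / 4 * e < h x -> 3 / 4 * e < h y -> F x = F y) ->
  (\int[mu]_x grad_length F x <= (k * P (enlargement A e `\` A))%:E)%E.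
Proof.
move=> e0 k0 lF Flt Fgt; have mAe := enlargement_measurable Aa0 e.
rewrite -integral_patch_cst; last exact: measurableD.
apply: ge0_le_lower_integral => x; first exact: grad_length_ge0.
rewrite patchE; case: ifPn => xD.
  apply: (@grad_length_le _ _ _ _ _ _ setT) => //.
  exact: (@filterT _ _ (@nbhs_filter T x)).
move: xD; rewrite notin_setE (enlargementE Aa0)/= => xD.
have [xe|xe] := ltP (h x) (e / 4).
  apply: (grad_length_le (lexx _) (nbhs_dist_fun_lt Aa0 xe)) => y ye.
  by rewrite (Flt _ y)// subrr normr0 mul0r.
(* Here [h x > 0] excludes [A], so a point off the shell has [h x >= e]. *)
have {}xe : 3 / 4 * e < h x.
  apply: (@lt_le_trans _ _ e); first lra.
  rewrite leNgt; apply/negP => xe'; apply: xD; split => // Ax.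
  by move: xe; rewrite (dist_fun_mem Aa0)//; lra.
apply: (grad_length_le (lexx _) (nbhs_dist_fun_gt Aa0 xe)) => y ye.
by rewrite (Fgt _ y)// subrr normr0 mul0r.
Qed.

(** Test with [l * F]: it equals [l] on [E], which bounds the integral of [Phi] from below, and is
    at most [l] times the indicator of [E'], which bounds the mean from above. *)
Lemma Phi_inequality_test (F : T -> R) (E E' : set (borel T)) (e l : R) :
  Phi_inequality -> 0 <= beta -> 0 < c -> 0 < e -> 0 < l ->
  measurable E -> measurable E' ->
  (forall x, 0 <= F x <= 1) -> lipschitz_with (2 / e) F ->
  (forall x y, h x < e / 4 -> h y < e / 4 -> F x = F y) ->
  (forall x y, 3 / 4 * e < h x -> 3 / 4 * e < h y -> F x = F y) ->
  (forall x, E x -> F x = 1) -> (forall x, ~ E' x -> F x = 0) ->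
  Phi beta l * P E - Phi beta (l * P E') <=
    c * (l * (2 / e) * P (enlargement A e `\` A)).
Proof.
move=> ineq b0 c0 e0 l0 mE mE' F01 lF Flt Fgt FE FE'.
pose f x := l * F x.
have f0 x : 0 <= f x by rewrite mulr_ge0 ?(ltW l0)//; case/andP: (F01 x).
have fl x : f x <= l by rewrite ler_piMr ?(ltW l0)//; case/andP: (F01 x).
have k0 : 0 < l * (2 / e) by rewrite mulr_gt0// divr_gt0.
have lf : lipschitz_with (l * (2 / e)) f.
  by move=> x y; rewrite /f -mulrBr normrM gtr0_norm// -[leRHS]mulrA ler_pM2l//.
have fi : mu.-integrable setT (EFin \o f).
  apply: measurable_bounded_integrable => //.
  - by apply: (le_lt_trans (probability_le1 mu measurableT)); rewrite ltry.
  - by apply: continuous_borel_measurable; exact: lipschitz_with_continuous lf.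
  - exists l; split; rewrite ?num_real// => y ly x _.
    by rewrite /= ger0_norm// (le_trans (fl x))// ltW.
have ineqf := ineq f (lipschitz_with_locally lf) fi.
have grad_le : (\int[mu]_x grad_length f x <=
    (l * (2 / e) * P (enlargement A e `\` A))%:E)%E.
  apply: integral_grad_length_le => //; first exact: ltW.
  - by move=> x y xe ye; rewrite /f (Flt x y).
  - by move=> x y xe ye; rewrite /f (Fgt x y).
rewrite -lee_fin; apply: (le_trans (le_trans _ ineqf)); last first.
  by rewrite EFinM lee_wpmul2l// lee_fin ltW.
rewrite EFinB; apply: leeB.
  rewrite -integral_patch_cst//; apply: ge0_le_lower_integral => x.
    by apply: erestrict_ge0 => y _; rewrite lee_fin Phi_ge0// ltW.
  rewrite patchE; case: ifPn => [|_]; last by rewrite lee_fin Phi_ge0.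
  by rewrite inE => /FE Fx; rewrite lee_fin ger0_norm// /f Fx mulr1.
rewrite lee_fin Phi_le//; first exact: Rintegral_ge0.
rewrite -[leRHS]/(fine (_%:E)) -integral_patch_cst// fine_le//.
- apply: integrable_fin_num => //.
  by apply: eq_integrable fi => // x _; rewrite /= ger0_norm.
- by rewrite integral_patch_cst.
apply: ge0_le_lower_integral => x; first by rewrite lee_fin.
rewrite patchE; case: ifPn => [_|].
  by rewrite lee_fin ger0_norm.
by rewrite notin_setE => /FE' Fx; rewrite lee_fin /f Fx mulr0 normr0.
Qed.

End test_function.

Section cutoff.
Context {R : realType} {N : nat} {d : metric R 'rV[R]_N}.
Local Notation T := (metric_space d).
Variable mu : probability (borel T) R.
Variables beta c : R.
Local Notation P X := (fine (mu X)).

Variables (A : set T) (a0 : T).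
Hypotheses (mA : measurable (A : set (borel T))) (Aa0 : A a0).
Local Notation h := (dist_fun A).

(** Affine in [h] between [e / 4] and [3 e / 4], whence the slope [2 / e]; the margins make it
    locally constant on [A] and off [A^e]. *)
Definition cutoff (e : R) (x : T) : R := clamp (3 / 2 - 2 * (h x / e)).

Lemma cutoff_lipschitz e : 0 < e -> lipschitz_with (2 / e) (cutoff e).
Proof.
move=> e0 x y; rewrite (le_trans (clamp_lipschitz _ _))//.
have -> : 3 / 2 - 2 * (h x / e) - (3 / 2 - 2 * (h y / e)) = 2 / e * (h y - h x).
  by field; rewrite gt_eqF.
rewrite normrM gtr0_norm ?divr_gt0// ler_pM2l ?divr_gt0// distrC.
by rewrite (le_trans (dist_fun_lipschitz Aa0 _ _))// mul1r.
Qed.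

Lemma cutoff_near e x : 0 < e -> h x < e / 4 -> cutoff e x = 1.
Proof.
move=> e0 xe; apply: clamp_eq1.
by have : h x / e < 4^-1; [rewrite ltr_pdivrMr//|]; lra.
Qed.

Lemma cutoff_far e x : 0 < e -> 3 / 4 * e < h x -> cutoff e x = 0.
Proof.
move=> e0 xe; apply: clamp_eq0.
by have : 3 / 4 < h x / e; [rewrite ltr_pdivlMr//|]; lra.
Qed.

Lemma fine_mu_onem (B : set (borel T)) : measurable B -> P (~` B) = 1 - P B.
Proof.
move=> mB; rewrite probability_setC// fineB//; exact: fin_num_measure.
Qed.

Lemma mu_enlargement e : 0 < e ->
  P (enlargement A e) = P A + P (enlargement A e `\` A).
Proof.
move=> e0; have mAe := enlargement_measurable Aa0 e.
have AAe : A `<=` enlargement A e.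
  by move=> x Ax; rewrite (enlargementE Aa0) /= (dist_fun_mem Aa0).
rewrite -fineD ?fin_num_measure//; last exact: measurableD.
rewrite -measureU//; first by rewrite setDUK.
- exact: measurableD.
- exact: setDIK.
Qed.

(** If [w = P A], the cutoff gives the bound with [w] and [w + m]; if [w = 1 - P A], its complement
    [G] gives it with [w - m] and [w]. The form with [w - m] and [w + m] is weaker than both. *)
Lemma Phi_inequality_enlargement (e l w : R)
    (m := P (enlargement A e `\` A)) :
  Phi_inequality mu beta c -> 0 <= beta -> 0 < c -> 0 < e -> 0 < l ->
  w = P A \/ w = 1 - P A ->
  Phi beta l * (w - m) - Phi beta (l * (w + m)) <= c * (l * (2 / e) * m).
Proof.
move=> ineq b0 c0 e0 l0 wE; have mAe := enlargement_measurable Aa0 e.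
have m0 : 0 <= m by rewrite fine_ge0.
have mAeE : P (enlargement A e) = P A + m by exact: mu_enlargement.
have far x : ~ enlargement A e x -> cutoff e x = 0.
  rewrite (enlargementE Aa0)/= => /negP; rewrite -leNgt => ex.
  by apply: cutoff_far => //; lra.
have near x : A x -> cutoff e x = 1.
  by move=> Ax; apply: cutoff_near => //; rewrite (dist_fun_mem Aa0)// divr_gt0.
have lF := cutoff_lipschitz e0.
have F01 x : 0 <= cutoff e x <= 1 by rewrite clamp_ge0 clamp_le1.
have Fnear x y : h x < e / 4 -> h y < e / 4 -> cutoff e x = cutoff e y.
  by move=> xe ye; rewrite !cutoff_near.
have Ffar x y : 3 / 4 * e < h x -> 3 / 4 * e < h y -> cutoff e x = cutoff e y.
  by move=> xe ye; rewrite !cutoff_far.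
have Pl0 : 0 <= Phi beta l by rewrite Phi_ge0// ltW.
case: wE => wE.
- have := Phi_inequality_test mA Aa0 ineq b0 c0 e0 l0 mA mAe F01 lF Fnear Ffar
    near far.
  rewrite mAeE -wE; apply: le_trans; rewrite lerB// ler_wpM2l//; lra.
- pose G x := 1 - cutoff e x.
  have G01 x : 0 <= G x <= 1.
    by have /andP[] := F01 x; rewrite /G; lra.
  have lG : lipschitz_with (2 / e) G.
    move=> x y; rewrite /G opprD addrACA subrr add0r -normrN opprD !opprK.
    exact: lF.
  have := Phi_inequality_test mA Aa0 ineq b0 c0 e0 l0
    (measurableC mAe) (measurableC mA) G01 lG.
  rewrite !fine_mu_onem// mAeE => H; apply: le_trans (H _ _ _ _).
  + rewrite -wE opprD addrA -wE lerB// Phi_le//.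
    * by rewrite mulr_ge0 ?(ltW l0)// wE -fine_mu_onem ?fine_ge0.
    * by rewrite ler_wpM2l ?(ltW l0)// lerDl.
  + by move=> x y xe ye; rewrite /G (Fnear x y).
  + by move=> x y xe ye; rewrite /G (Ffar x y).
  + by move=> x /far Fx; rewrite /G Fx subr0.
  + by move=> x /contrapT /near Fx; rewrite /G Fx subrr.
Qed.

End cutoff.

(** * From the shell inequality to the logarithmic profile *)

Section log_profile.
Context {R : realType}.

(** The fraction of [L] surviving the subtraction: [1 + 1 / w >= 3] for [w <= 1 / 2], while
    [2 + m / w <= 5 / 2] for [m <= w / 2]. *)
Definition log_ratio (beta : R) := 1 - (ln (5 / 2) / ln 3) `^ beta.

Lemma log_ratio_gt0 (beta : R) : 0 < beta -> 0 < log_ratio beta <= 1.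
Proof.
move=> b0; rewrite /log_ratio subr_gt0 lerBlDr lerDl powR_ge0 andbT.
have l3 : 0 < ln (3 : R) by rewrite ln_gt0; lra.
have l5 : 0 < ln (5 / 2 : R) by rewrite ln_gt0; lra.
rewrite -[ltRHS](congr1 (@^~ beta) (@powR1 R)) gt0_ltr_powR ?nnegrE//.
  by rewrite divr_ge0// ltW.
by rewrite ltr_pdivrMr// mul1r ltr_ln ?posrE; lra.
Qed.

(* With [l = w^-1] the first [Phi] contributes [(w - m) * L], the second at most
   [(w + m) * ln (5 / 2) `^ beta] as soon as [m <= w / 2]; all terms carrying a
   factor [m] are absorbed on the right because [e * L <= 1 / 2]. *)
Lemma log_profile_le (beta c w m e : R) (L := ln (1 + w^-1) `^ beta) :
  0 < beta -> 0 < c -> 0 < w <= 2^-1 -> 0 <= m -> 0 < e -> e * (2 * L) <= 1 ->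
  Phi beta w^-1 * (w - m) - Phi beta (w^-1 * (w + m)) <=
    c * (w^-1 * (2 / e) * m) ->
  log_ratio beta * log_profile beta w <= (2 * c + 2) * (m / e).
Proof.
move=> b0 c0 /andP[w0 w2] m0 e0 eL H.
have /andP[k0 k1] := log_ratio_gt0 b0.
have l3 : 0 < ln (3 : R) by rewrite ln_gt0; lra.
have l5 : 0 < ln (5 / 2 : R) by rewrite ln_gt0; lra.
have wV : 2 <= w^-1 by rewrite -[leLHS]invrK lef_pV2 ?posrE ?invr_gt0.
have L3 : ln 3 <= ln (1 + w^-1) by rewrite ler_ln ?posrE; lra.
have L0 : 0 < L by rewrite powR_gt0//; lra.
have me0 : 0 <= m / e by rewrite divr_ge0// ltW.
rewrite /log_profile -/L.
(* A shell with [m > w / 2] suffices by itself: [e * L <= 1 / 2] gives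
   [w * L <= w / (2 e) < m / e]. *)
have [mw|mw] := leP m (w / 2); last first.
  have wL : w * L <= m / e.
    rewrite ler_pdivlMr// (le_trans _ (ltW mw))//.
    have : w * (e * (2 * L)) <= w * 1 by rewrite ler_pM2l.
    lra.
  apply: (@le_trans _ _ (w * L)); first by rewrite ler_piMl// mulr_ge0// ltW.
  rewrite (le_trans wL)// ler_peMl//; lra.
set l := ln (5 / 2) `^ beta.
have lL : l <= (1 - log_ratio beta) * L.
  rewrite /log_ratio opprB addrC subrK /L.
  rewrite -powRM ?(divr_ge0 (ltW l5) (ltW l3))//; last lra.
  apply: ge0_ler_powR; rewrite ?nnegrE ?(ltW b0) ?(ltW l5)//.
    by rewrite mulr_ge0 ?(divr_ge0 (ltW l5) (ltW l3))//; lra.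
  by rewrite -mulrA ler_peMr ?(ltW l5)// mulrC ler_pdivlMr// mul1r.
have Phi1 : Phi beta (w^-1 * (w + m)) <= (1 + m / w) * l.
  have -> : w^-1 * (w + m) = 1 + m / w by field; rewrite gt_eqF.
  have mw2 : m / w <= 2^-1 by rewrite ler_pdivrMr// mulrC.
  have mw0 : 0 <= m / w by rewrite divr_ge0// ltW.
  rewrite /Phi ler_pM2l; last lra.
  apply: ge0_ler_powR; rewrite ?nnegrE ?ln_ge0 ?(ltW b0)//; try lra.
  by rewrite ler_ln ?posrE; lra.
have {}H : (w - m) * L - (w + m) * l <= 2 * c * (m / e).
  have : w * ((w - m) * (w^-1 * L) - (1 + m / w) * l)
      <= w * (c * (w^-1 * (2 / e) * m)).
    rewrite ler_pM2l// (le_trans _ H)// mulrC lerB//.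
  congr (_ <= _); field; rewrite ?gt_eqF//.
have mL : m * L <= m / e.
  rewrite ler_pdivlMr// -mulrA ler_piMr//.
  have : 0 < e * L by rewrite mulr_gt0.
  lra.
have ml : m * l <= m * L.
  rewrite ler_wpM2l// (le_trans lL)// ler_piMl ?(ltW L0)//; lra.
(* Thus [log_ratio beta * (w * L) <= w * L - w * l], which by [H] is at most
   [2 c m / e + m * L + m * l]; the last two terms are at most [m / e] each. *)
have wl : w * l <= w * ((1 - log_ratio beta) * L) by rewrite ler_pM2l.
lra.
Qed.

End log_profile.

(** * Lower bound on the surface measure and conclusion *)

Section surface_measure.
Context {R : realType} {N : nat} {d : metric R 'rV[R]_N}.
Local Notation T := (metric_space d).
Variable mu : probability (borel T) R.
Implicit Types (A : set (borel T)).
Local Notation P X := (fine (mu X)).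

Lemma surface_measure_ge A (K : \bar R) (e0 : R) : 0 < e0 ->
  (forall e, 0 < e < e0 -> (K <= mu (enlargement A e `\` A) * (e^-1)%:E)%E) ->
  (K <= surface_measure mu A)%E.
Proof.
move=> e00 KA; rewrite /surface_measure limf_einfE.
pose V := [set e : R | 0 < e < e0].
apply: (@le_trans _ _ (ereal_inf
    [set (mu (enlargement A e `\` A) * (e^-1)%:E)%E | e in V])).
  by apply: le_ereal_inf_tmp => _ /= [e eV <-]; exact: KA.
apply: ereal_sup_ubound; exists V => //.
near=> e; apply/andP; split; first by [].
by near: e; exact: nbhs_right_lt.
Unshelve. all: by end_near. Qed.

Lemma surface_measure_ge0 A : (0 <= surface_measure mu A)%E.
Proof.
apply: (@surface_measure_ge _ _ 1) => // e /andP[e0 _].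
by rewrite mule_ge0// lee_fin invr_ge0 ltW.
Qed.

Lemma log_profile_le_surface_measure (beta c : R) A :
  Phi_inequality mu beta c -> 0 < beta -> 0 < c -> measurable A ->
  0 < P A < 1 ->
  ((log_ratio beta * log_profile beta (Num.min (P A) (1 - P A))
      / (2 * c + 2))%:E
    <= surface_measure mu A)%E.
Proof.
move=> ineq b0 c0 mA /andP[A0 A1].
have [a Aa] : exists a, A a.
  apply/set0P/negP => /eqP A_0; move: A0; rewrite A_0 measure0 ltxx//.
set w := Num.min _ _.
have w0 : 0 < w by rewrite lt_min A0 subr_gt0.
have w2 : w <= 2^-1.
  by rewrite /w ge_min; have [//|/ltW h] := leP (P A) 2^-1; lra.
have wE : w = P A \/ w = 1 - P A.
  by rewrite /w /Num.min; case: ifP; [left|right].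
pose L := ln (1 + w^-1) `^ beta.
have L0 : 0 < L.
  by rewrite powR_gt0// ln_gt0// ltrDl invr_gt0.
(* Below this threshold [e * (2 * L) <= 1], as [log_profile_le] requires. *)
apply: (@surface_measure_ge _ _ (2 * L)^-1); first by rewrite invr_gt0 mulr_gt0.
move=> e /andP[e0 eL]; have mAe := enlargement_measurable Aa e.
rewrite -[mu _]fineK ?fin_num_measure//; last exact: measurableD.
rewrite -EFinM lee_fin ler_pdivrMr; last lra.
rewrite [leRHS]mulrC; apply: log_profile_le => //.
- by rewrite w0.
- exact: fine_ge0.
- by rewrite -ler_pdivlMr ?mulr_gt0// mul1r ltW.
- apply: (Phi_inequality_enlargement mA Aa ineq) => //; first exact: ltW.
  by rewrite invr_gt0.
Qed.

End surface_measure.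

Theorem theorem3p1 (R : realType) (N : nat) (d : metric R 'rV[R]_N)
    (mu : probability (borel (metric_space d)) R) (beta c : R)
    (mu_na : non_atomic mu) (beta01 : 0 < beta <= 1) (c_gt0 : 0 < c)
    (Phi_ineq : forall f : metric_space d -> R,
      locally_lipschitz f -> mu.-integrable setT (EFin \o f) ->
      (\int[mu]_x (Phi beta `|f x|)%:E - (Phi beta (\int[mu]_x `|f x|)%R)%:E
       <= c%:E * \int[mu]_x grad_length f x)%E) :
  let q := beta^-1 in
  1 < q ->
  exists ct : R, [/\ 0 < ct,
    forall t : R, 0 <= t <= 1 ->
      ((ct^-1 * U_ q t)%:E <= isoperimetric_profile mu t)%E
  & forall (A : set (borel (metric_space d))) (t : R),
      measurable A -> mu A = t%:E ->
      ((U_ q t)%:E <= ct%:E * surface_measure mu A)%E].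
Proof.
move=> q q1; have /andP[b0 _] := beta01.
have b1 : beta < 1 by rewrite -invf_gt1.
have /andP[k0 _] := log_ratio_gt0 b0.
have [C C0 UC] := U_le b0 b1.
(* [C] compares [U_ q] with [log_profile]; the other factors invert the constant of
   [log_profile_le_surface_measure]. *)
pose ct := C * (2 * c + 2) / log_ratio beta.
have ct0 : 0 < ct by rewrite divr_gt0// mulr_gt0//; lra.
have U_surface (A : set (borel (metric_space d))) (t : R) :
    measurable A -> mu A = t%:E ->
    ((U_ q t)%:E <= ct%:E * surface_measure mu A)%E.
  (* For [t] outside []0, 1[], [U_ q t] is 0 by definition. *)
  move=> mA muA; have [t01|t01] := boolP (0 < t < 1); last first.
    rewrite /U_ (negbTE t01) mule_ge0 ?surface_measure_ge0//.
    by rewrite lee_fin ltW.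
  have AE : fine (mu A) = t by rewrite muA.
  have := @log_profile_le_surface_measure _ _ _ mu _ _ A Phi_ineq b0 c_gt0 mA.
  rewrite AE => /(_ t01) H.
  have ct0' : (0 <= ct%:E)%E by rewrite lee_fin ltW.
  apply: le_trans (lee_wpmul2l ct0' H).
  rewrite -EFinM lee_fin (le_trans (UC t t01))// le_eqVlt; apply/orP; left.
  by apply/eqP; rewrite /ct; field; rewrite !gt_eqF//; lra.
exists ct; split => // t t01; rewrite /isoperimetric_profile.
case: ifPn => [t_01|_].
  rewrite /U_ ifF ?mulr0//; apply/negbTE.
  by case/orP: t_01 => /eqP ->; rewrite ltxx ?andbF.
apply: le_ereal_inf_tmp => _ /= [A [mA muA] <-].
have ctV : (0 <= (ct^-1)%:E)%E by rewrite lee_fin invr_ge0 ltW.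
have := lee_wpmul2l ctV (U_surface A t mA muA).
by rewrite muleA -!EFinM mulVf ?gt_eqF// mul1e.
Qed.
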